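(* The following bounds hold (each for the integers $n$ for which the quantities $T(n,m)$ appearing in it are defined, i.e. $n\ge m$): \[ T(n,3)\le T(n,2)\le \left(\frac32\right)^n\frac{10}{n},\qquad T(n,4)\le \left(\frac32\right)^n\frac{44}{n^2},\qquad T(n,5)\le \left(\frac32\right)^n\frac{232}{n^3}. \]
   Context: Three words $x,y,z\in\{0,1,2\}^n$ triffer at position $i$ if $\{x_i,y_i,z_i\}=\{0,1,2\}$. For integers $n\ge m\ge 1$, a code $C\subseteq\{0,1,2\}^n$ is $m$-trifferent if any three distinct codewords of $C$ triffer in at least $m$ positions. $T(n,m)$ denotes the largest size of an $m$-trifferent code $C\subseteq\{0,1,2\}^n$. *)

(* Defs.v *)
From mathcomp Require Import all_boot all_order all_algebra.

Set Implicit Arguments.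
Unset Strict Implicit.
Unset Printing Implicit Defensive.

Definition word (n : nat) := {ffun 'I_n -> 'I_3}.

Definition triffer_at (n : nat) (x y z : word n) (i : 'I_n) : bool :=
  [set x i; y i; z i] == [set: 'I_3].

Definition trifferent (n m : nat) (C : {set word n}) : bool :=
  [forall x in C, forall y in C, forall z in C,
    [&& x != y, y != z & x != z] ==> (m <= #|[set i | triffer_at x y z i]|)].

(* The set of m-trifferent codes is never empty (set0 qualifies vacuously), so
   the maximum below is attained.  It is meant for 1 <= m <= n only. *)
Definition T (n m : nat) : nat :=
  \max_(C : {set word n} | trifferent m C) #|C|.

(* Main.v *)
Require Import Defs.
From mathcomp Require Import all_boot all_order all_algebra.
From mathcomp Require Import zify ring lra.
Set Implicit Arguments.
Unset Strict Implicit.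
Unset Printing Implicit Defensive.
Import Order.TTheory GRing.Theory Num.Theory.
Local Open Scope ring_scope.

(* Fix a word r.  Where three codewords triffer, exactly one of them agrees with
   r, so double counting triffering triples bounds the number of codewords that
   rarely agree with r: at most 5 have k agreements or fewer when 9k < 5m.
   Averaging over r settles m = 2 (k = 1) and m = 4 (k = 2).

   For m = 5, let r avoid a codeword x everywhere: then at most two other
   codewords agree with r at most 3 times.  Averaging over such r gives, for every
   codeword x and with d = d(x, y),
     \sum_(y != x) 2^-d (1 + d + C(d,2) + C(d,3)) <= 2.
   On the other hand codewords cannot be too far apart on average.  For n < 32 this
   is Plotkin's bound on the mean distance, combined with the convexity of the
   summand for d >= 5.  For n >= 32 it is Delsarte's linear programming bound: with
   y = (n - 3j)/2, the spectral weights 4^-j f(y), where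
     f(y) = (3n/5 - y) (kappa_4(y) + n kappa_3(y) / 5)^2 >= 0,
   have transform (3/2)^n 2^-d p(d), and p(d) is at most
   n^6/21 (1 + d + C(d,2) + C(d,3)) for 5 <= d <= n. *)

(** * Counting triffering triples *)

Definition agree n (x y : word n) : nat := #|[set i | x i == y i]|.
Definition dist n (x y : word n) : nat := #|[set i | x i != y i]|.

Lemma card_set_sum (I : finType) (P : pred I) : #|[set i | P i]| = (\sum_i P i)%N.
Proof.
rewrite -sum1dep_card [LHS]big_mkcond /=.
by apply: eq_bigr => i _; case: ifP.
Qed.

Lemma triffer_atE n (x y z : word n) i :
  triffer_at x y z i = [&& x i != y i, y i != z i & x i != z i].
Proof.
rewrite /triffer_at; set a := x i; set b := y i; set c := z i.
apply/eqP/and3P => [E|[ab bc ac]].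
  have : #|[set a; b; c]| = 3 by rewrite E cardsT card_ord.
  by rewrite -setUA cardsU1 cards2 !inE; case: (a == b); case: (b == c); case: (a == c).
apply/eqP; rewrite eqEcard subsetT cardsT card_ord /= -setUA cardsU1 cards2 !inE.
by rewrite (negPf ab) (negPf ac) bc.
Qed.

Lemma agree_dist n (x y : word n) : (agree x y + dist x y = n)%N.
Proof.
rewrite /agree /dist -[RHS](card_ord n) -cardsT.
rewrite -[in RHS](cardsID [set i | x i == y i]) setTI setTD.
by congr (_ + _)%N; apply: eq_card => i; rewrite !inE.
Qed.

Lemma trifferentP n m (C : {set word n}) :
  reflect {in C & &, forall x y z, x != y -> y != z -> x != z ->
            (m <= #|[set i | triffer_at x y z i]|)%N} (trifferent m C).
Proof.
apply: (iffP forall_inP) => [H x y z xC yC zC xy yz xz|H x xC].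
  have /forall_inP /(_ y yC) /forall_inP /(_ z zC) /implyP := H x xC.
  by apply; rewrite xy yz.
apply/forall_inP => y yC; apply/forall_inP => z zC; apply/implyP => /and3P[].
exact: H.
Qed.

(* If the three symbols occur a, b, c times at position i, then exactly 6abc
   ordered triples of words triffer there. *)
Lemma triffer_count n (B : {set word n}) (r : word n) (i : 'I_n) :
  (\sum_(x in B) \sum_(y in B) \sum_(z in B) triffer_at x y z i
    <= 6 * ((#|B| - 1) ^ 2 %/ 4) * \sum_(x in B) (x i == r i))%N.
Proof.
set K := #|B|.
pose c s := (\sum_(x in B) (x i == s))%N.
have sumc (g : 'I_3 -> nat) : (\sum_(x in B) g (x i) = \sum_s c s * g s)%N.
  under [RHS]eq_bigr do rewrite /c big_distrl /=.
  rewrite exchange_big; apply: eq_bigr => x _.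
  rewrite (bigD1 (x i)) //= eqxx mul1n big1 ?addn0 // => s /negPf.
  by rewrite eq_sym => ->.
under eq_bigr => x _ do under eq_bigr => y _ do
  (under eq_bigr => z _ do rewrite triffer_atE).
under eq_bigr => x _ do under eq_bigr => y _ do
  (rewrite (sumc (fun u => [&& x i != y i, y i != u & x i != u] : nat))).
under eq_bigr => x _ do
  (rewrite (sumc (fun t => \sum_u c u * [&& x i != t, t != u & x i != u])%N)).
rewrite (sumc (fun s => \sum_t c t * \sum_u c u * [&& s != t, t != u & s != u])%N).
have sumK : (c ord0 + c (inord 1) + c (inord 2) = K)%N.
  have := sumc (fun=> 1%N); rewrite sum1_card -/K => ->.
  rewrite !big_ord_recl big_ord0 /= !muln1 addn0 !addnA.
  by congr (_ + c _ + c _)%N; apply: val_inj; rewrite /= inordK.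
set a := c ord0 in sumK *; set b := c (inord 1) in sumK *.
set d := c (inord 2) in sumK *.
have -> : (\sum_s c s * \sum_t c t * \sum_u c u * [&& s != t, t != u & s != u]
   = 6 * (a * b * d))%N.
  rewrite !big_ord_recl !big_ord0 /=.
  have -> : lift ord0 ord0 = inord 1 :> 'I_3 by apply: val_inj; rewrite /= inordK.
  have -> : lift ord0 (lift ord0 ord0) = inord 2 :> 'I_3.
    by apply: val_inj; rewrite /= inordK.
  by rewrite -/a -/b -/d; ring.
(* Here w counts the symbol [r i]. If w > 0 then u + v <= K - 1, and AM-GM bounds the integer uv by
   the floor of (K - 1)^2 / 4. *)
have am (u v w : nat) : (u + v + w = K -> u * v * w <= ((K - 1) ^ 2 %/ 4) * w)%N.
  case: w => [|w] E; first by rewrite !muln0.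
  rewrite leq_mul2r /= leq_divRL //.
  have -> : (K - 1 = u + v + w)%N by lia.
  apply: (@leq_trans ((u + v) ^ 2)); last by rewrite leq_exp2r ?leq_addr.
  by rewrite mulnC nat_AGM2.
rewrite -[leqRHS]mulnA leq_mul2l /= -/(c (r i)).
case: (r i) => -[|[|[|//]]] lt3.
- have -> : Ordinal lt3 = ord0 by apply: val_inj.
  by have := am b d a ltac:(lia); rewrite -/a; lia.
- have -> : Ordinal lt3 = inord 1 by apply: val_inj; rewrite /= inordK.
  by have := am a d b ltac:(lia); rewrite -/b; lia.
- have -> : Ordinal lt3 = inord 2 by apply: val_inj; rewrite /= inordK.
  by have := am a b d ltac:(lia); rewrite -/d; lia.
Qed.

(** Sum [triffer_count] over the positions: each ordered triple of distinct words of B is counted at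
    least m times. *)
Lemma agree_lower_bound n m (C B : {set word n}) (r : word n) :
  trifferent m C -> B \subset C ->
  (#|B| * (#|B| - 1) * (#|B| - 2) * m
    <= 6 * ((#|B| - 1) ^ 2 %/ 4) * \sum_(x in B) agree x r)%N.
Proof.
move=> /trifferentP trC /subsetP sBC.
pose tot := (\sum_i \sum_(x in B) \sum_(y in B) \sum_(z in B) triffer_at x y z i)%N.
apply: (@leq_trans tot).
  have -> : tot = (\sum_(x in B) \sum_(y in B) \sum_(z in B)
                    #|[set i | triffer_at x y z i]|)%N.
    rewrite /tot exchange_big; apply: eq_bigr => x _.
    rewrite exchange_big; apply: eq_bigr => y _.
    rewrite exchange_big; apply: eq_bigr => z _.
    by rewrite card_set_sum.
  rewrite -!mulnA -sum_nat_const leq_sum // => x xB.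
  apply: (@leq_trans (\sum_(y in B :\ x) (#|B| - 2) * m)%N).
    by rewrite sum_nat_const (cardsD1 x B) xB add1n subn1.
  rewrite (big_setD1 x xB) /=.
  apply: (leq_trans _ (leq_addl _ _)); apply: leq_sum => y yB.
  apply: (@leq_trans (\sum_(z in B :\ x :\ y) m)%N).
    rewrite sum_nat_const leq_mul2r; apply/orP; right.
    by rewrite (cardsD1 x B) xB (cardsD1 y (B :\ x)) yB !add1n subn2.
  move: (yB); rewrite !inE => /andP[yx yB'].
  rewrite (big_setD1 x xB) /= (big_setD1 y yB) /= addnA.
  apply: (leq_trans _ (leq_addl _ _)); apply: leq_sum => z.
  rewrite !inE => /and3P[zy zx zB].
  by apply: trC; rewrite ?sBC // eq_sym.
have -> : (\sum_(x in B) agree x r = \sum_i \sum_(x in B) (x i == r i))%N.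
  rewrite exchange_big; apply: eq_bigr => x _.
  by rewrite /agree card_set_sum.
by rewrite big_distrr /=; apply: leq_sum => i _; apply: triffer_count.
Qed.

(** Testing subsets of size exactly k + 1 lets the counting inequality be used with numeric
    cardinals. *)
Lemma card_subset_le (T : finType) (A : {set T}) k :
  (forall B : {set T}, B \subset A -> #|B| = k.+1 -> False) -> (#|A| <= k)%N.
Proof.
move=> H; rewrite leqNgt; apply/negP => lt.
have [B sB cB] : exists2 B : {set T}, B \subset A & #|B| = k.+1.
  move: lt; rewrite cardE => lt.
  exists [set:: take k.+1 (enum A)].
    by apply/subsetP => x; rewrite inE => /mem_take; rewrite mem_enum.
  rewrite cardsE; have /card_uniqP -> : uniq (take k.+1 (enum A)).
    by rewrite take_uniq // enum_uniq.
  by rewrite size_takel.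
exact: H sB cB.
Qed.

(** * Averaging over r *)

Lemma sum_ord3 (V : zmodType) (a : 'I_3) (F : 'I_3 -> V) (u v : V) :
  F a = u -> (forall s, s != a -> F s = v) -> \sum_s F s = u + v *+ 2.
Proof.
move=> Fa Fv; rewrite (bigD1 a) //= Fa; congr (_ + _).
by rewrite (eq_bigr _ Fv) sumr_const cardC1 card_ord.
Qed.

(** Agreement is additive over positions, so sums of this monomial over r factor into products. *)
Lemma polyXn_agree n (x r : word n) :
  'X^(agree x r) = \prod_i (if x i == r i then 'X else 1) :> {poly rat}.
Proof. by rewrite -big_mkcond /= prodr_const /agree cardsE. Qed.

Lemma coef_sumXn (I : finType) (P : pred I) (e : I -> nat) k :
  (\sum_(i | P i) 'X^(e i) : {poly rat})`_k
    = #|[set i | P i && (e i == k)]|%:R.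
Proof.
rewrite coef_sum card_set_sum natr_sum big_mkcond; apply: eq_bigr => i _ /=.
by case: (P i) => //=; rewrite coefXn eq_sym.
Qed.

Lemma card_agree n (x : word n) k :
  #|[set r | agree x r == k]| = ('C(n, k) * 2 ^ (n - k))%N.
Proof.
have gen : \sum_(r : word n) 'X^(agree x r) = ('X + 2%:R) ^+ n :> {poly rat}.
  under eq_bigr do rewrite polyXn_agree.
  rewrite -(bigA_distr_bigA (fun i s => if x i == s then 'X else 1)).
  rewrite (eq_bigr (fun=> 'X + 2%:R)) ?prodr_const ?card_ord // => i _.
  apply: (sum_ord3 (a := x i)); first by rewrite eqxx.
  by move=> s /negPf; rewrite eq_sym => ->.
have := congr1 (fun p : {poly rat} => p`_k) gen.
rewrite coef_sumXn /= addrC exprDn coef_sum => E.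
apply/eqP; rewrite -(eqr_nat rat) E; apply/eqP.
have coefE i : ((2%:R : {poly rat}) ^+ (n - i) * 'X^i *+ 'C(n, i))`_k
    = if i == k then ('C(n, k) * 2 ^ (n - k))%:R else 0.
  rewrite -polyC_natr -polyC_exp mul_polyC coefMn coefZ coefXn eq_sym.
  case: eqP => [->|_]; last by rewrite mulr0 mul0rn.
  by rewrite mulr1 natrM natrX mulr_natl.
under eq_bigr do rewrite coefE.
have [lt|ge] := ltnP k n.+1.
  rewrite (bigD1 (Ordinal lt)) //= eqxx big1 ?addr0 // => i /negPf.
  by rewrite -val_eqE /= => ->.
by rewrite bin_small // mul0n big1 // => i _; case: eqP.
Qed.

Lemma coef_exp1DX d k : ((1 + 'X) ^+ d : {poly rat})`_k = 'C(d, k)%:R.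
Proof.
rewrite exprDn coef_sum.
under eq_bigr do rewrite expr1n mul1r coefMn coefXn.
have [lt|ge] := ltnP k (d).+1.
  rewrite (bigD1 (Ordinal lt)) //= eqxx big1 ?addr0 // => i /negPf.
  by rewrite -val_eqE /= eq_sym => ->; rewrite mul0rn.
rewrite bin_small // big1 // => i _; case: eqP => [E'|]; last by rewrite mul0rn.
by move: (ltn_ord i); rewrite -E' ltnNge ge.
Qed.

(** When r avoids x, a position where x and y differ leaves the symbol of y and a third one, giving
    1 + X; a position where they coincide leaves two symbols, neither agreeing with y, giving 2. *)
Lemma card_avoid_agree n (x y : word n) k :
  #|[set r | (agree x r == 0%N) && (agree y r == k)]|
    = (2 ^ (n - dist x y) * 'C(dist x y, k))%N.
Proof.
have gen : \sum_(r : word n | agree x r == 0%N) 'X^(agree y r)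
    = (2 ^ (n - dist x y))%:R * (1 + 'X) ^+ dist x y :> {poly rat}.
  pose F i s : {poly rat} :=
    if x i == s then 0 else if y i == s then 'X else 1.
  have -> : \sum_(r : word n | agree x r == 0%N) 'X^(agree y r)
      = \sum_(r : word n) \prod_i F i (r i) :> {poly rat}.
    rewrite big_mkcond; apply: eq_bigr => r _; case: ifP => [a0|a0].
      rewrite polyXn_agree; apply: eq_bigr => i _; rewrite /F.
      case: (boolP (x i == r i)) => // xr; move: a0; rewrite /agree cards_eq0.
      by move/eqP/setP/(_ i); rewrite !inE xr.
    have [i] : exists i, x i == r i.
      move/negbT: a0; rewrite /agree cards_eq0 => /set0Pn[i].
      by rewrite inE; exists i.
    by move=> xr; rewrite (bigD1 i) //= /F xr mul0r.
  rewrite -(bigA_distr_bigA F).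
  rewrite (eq_bigr (fun i => if x i != y i then 1 + 'X else 2%:R)); last first.
    move=> i _; rewrite /F; case: ifP => [xy|/negbFE/eqP <-].
      move: xy; case: (x i) => [[|[|[|//]]] ?]; case: (y i) => [[|[|[|//]]] ?] // _;
        by rewrite !big_ord_recl big_ord0 /=; ring.
    rewrite (sum_ord3 (a := x i) (u := 0) (v := 1)) ?eqxx ?add0r //.
    by move=> s /negPf; rewrite eq_sym => ->.
  rewrite (bigID (fun i => x i != y i)) /=.
  rewrite (eq_bigr (fun=> 1 + 'X)) => [|i ->//].
  rewrite [X in _ * X](eq_bigr (fun=> 2%:R)) => [|i /negPf -> //].
  rewrite !prodr_const mulrC natrX; congr (_ ^+ _ * _ ^+ _).
    rewrite -[X in (X - _)%N](agree_dist x y) addnK /agree cardsE.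
    by apply: eq_card => i; apply: negbK.
  by rewrite /dist cardsE.
have := congr1 (fun p : {poly rat} => p`_k) gen.
rewrite coef_sumXn /= => E.
apply/eqP; rewrite -(eqr_nat rat) E natrM; apply/eqP.
by rewrite -polyC_natr coefCM coef_exp1DX.
Qed.

Lemma card_leq_agree n (P : pred (word n)) (x : word n) k :
  (#|[set r | P r && (agree x r <= k)]|
    = \sum_(i < k.+1) #|[set r | P r && (agree x r == i)]|)%N.
Proof.
rewrite card_set_sum; under [RHS]eq_bigr do rewrite card_set_sum.
rewrite exchange_big; apply: eq_bigr => r _.
case: (P r) => /=; last by rewrite big1.
have [lt|ge] := leqP (agree x r) k.
  rewrite (bigD1 (Ordinal (lt : (_ < k.+1)%N))) //= eqxx big1 // => i.
  by rewrite -val_eqE /= eq_sym => /negPf ->.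
rewrite big1 // => i _; case: eqP => // E.
by move: (ltn_ord i); rewrite -E ltnS leqNgt ge.
Qed.

(** Double counting of the pairs (x, r) with x in C and [agree x r <= k]. *)
Lemma ball_bound n (C : {set word n}) k N :
  (forall r, #|[set x in C | agree x r <= k]| <= N)%N ->
  (#|C| * \sum_(i < k.+1) 'C(n, i) * 2 ^ (n - i) <= N * 3 ^ n)%N.
Proof.
move=> H.
have -> : (3 ^ n = #|{: word n}|)%N by rewrite card_ffun !card_ord.
have -> : (#|C| * \sum_(i < k.+1) 'C(n, i) * 2 ^ (n - i)
    = \sum_(r : word n) #|[set x in C | agree x r <= k]|)%N.
  under [RHS]eq_bigr do rewrite card_set_sum.
  rewrite exchange_big -sum_nat_const big_mkcond; apply: eq_bigr => x _ /=.
  case: (x \in C); last by rewrite big1.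
  rewrite -card_set_sum (card_leq_agree predT).
  by apply: eq_bigr => i _; rewrite -(card_agree x).
by rewrite mulnC -sum_nat_const; apply: leq_sum.
Qed.

(** Six such words would give 6 * 5 * 4 * m <= 36 * 6k in [agree_lower_bound], that is 5m <= 9k. *)
Lemma sparse_agree_le5 n m k (C : {set word n}) (r : word n) :
  trifferent m C -> (9 * k < 5 * m)%N ->
  (#|[set x in C | agree x r <= k]| <= 5)%N.
Proof.
move=> trC lt; apply: card_subset_le => B sB cB.
have sBC : B \subset C.
  by apply: (subset_trans sB); apply/subsetP => x; rewrite inE => /andP[].
have := agree_lower_bound r trC sBC.
have : (\sum_(x in B) agree x r <= 6 * k)%N.
  rewrite -cB -sum_nat_const; apply: leq_sum => x /(subsetP sB).
  by rewrite inE => /andP[].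
by rewrite cB (_ : (6 - 1) ^ 2 %/ 4 = 6)%N //; lia.
Qed.

(** Three such words together with x, which contributes no agreement, would give 4 * 3 * 2 * 5 = 120
    <= 12 * 9 = 108. *)
Lemma sparse_agree_le2 n (C : {set word n}) (x r : word n) :
  trifferent 5 C -> x \in C -> agree x r = 0%N ->
  (#|[set y in C :\ x | agree y r <= 3]| <= 2)%N.
Proof.
move=> trC xC xr; apply: card_subset_le => B sB cB.
have xB : x \notin B by apply/negP => /(subsetP sB); rewrite !inE eqxx.
have sBC : x |: B \subset C.
  apply/subsetP => y /setU1P[->//|/(subsetP sB)].
  by rewrite !inE -andbA => /and3P[].
have := agree_lower_bound r trC sBC.
have : (\sum_(y in B) agree y r <= 3 * 3)%N.
  rewrite -[X in (_ <= X * _)%N]cB -sum_nat_const; apply: leq_sum => y /(subsetP sB).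
  by rewrite inE => /andP[].
by rewrite cardsU1 xB cB big_setU1 //= xr (_ : (1 + 3 - 1) ^ 2 %/ 4 = 2)%N //; lia.
Qed.

(** Among the 2^n words r avoiding x, this counts, up to the factor 2^(n - d), those agreeing at
    most 3 times with a word at distance d from x. *)
Definition ball3 (d : nat) : nat := (1 + d + 'C(d, 2) + 'C(d, 3))%N.

(** Double counting of pairs (y, r) with r avoiding x: each of the 2^n words r serves at most two
    y. *)
Lemma weighted_dist_sum n (C : {set word n}) (x : word n) :
  trifferent 5 C -> x \in C ->
  \sum_(y in C :\ x) (ball3 (dist x y))%:R / 2%:R ^+ dist x y <= 2%:R :> rat.
Proof.
move=> trC xC.
rewrite -(ler_pM2r (_ : 0 < (2 ^ n)%:R)) ?ltr0n ?expn_gt0 // -natrM mulr_suml.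
have -> : \sum_(y in C :\ x) (ball3 (dist x y))%:R / 2%:R ^+ dist x y * (2 ^ n)%:R
   = (\sum_(y in C :\ x)
        #|[set r | (agree x r == 0%N) && (agree y r <= 3)%N]|)%:R :> rat.
  rewrite natr_sum; apply: eq_bigr => y _.
  rewrite card_leq_agree; under eq_bigr do rewrite card_avoid_agree.
  rewrite -big_distrr natrM /=.
  rewrite !big_ord_recr big_ord0 /= add0n bin0 bin1 -/(ball3 _).
  have le : (dist x y <= n)%N by have := agree_dist x y; lia.
  have -> : (2 ^ n = 2 ^ (n - dist x y) * 2 ^ dist x y)%N by rewrite -expnD subnK.
  by rewrite natrM [(2 ^ dist x y)%:R]natrX mulrCA mulfVK ?expf_neq0.
rewrite ler_nat.
have -> : (\sum_(y in C :\ x) #|[set r | (agree x r == 0) && (agree y r <= 3)]|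
   = \sum_(r | agree x r == 0) #|[set y in C :\ x | agree y r <= 3]|)%N.
  under eq_bigr do rewrite card_set_sum.
  rewrite exchange_big [RHS]big_mkcond; apply: eq_bigr => r _ /=.
  case: (agree x r == 0)%N; last by rewrite big1.
  rewrite card_set_sum [LHS]big_mkcond; apply: eq_bigr => y _ /=.
  by case: (y \in _).
apply: (@leq_trans (\sum_(r | agree x r == 0) 2)%N).
  by apply: leq_sum => r /eqP; apply: sparse_agree_le2.
by rewrite sum_nat_const -cardsE card_agree bin0 mul1n subn0 mulnC.
Qed.

(** There is a third codeword, and x and y differ wherever they triffer with it. *)
Lemma dist_ge5 n (C : {set word n}) (x y : word n) :
  trifferent 5 C -> (2 < #|C|)%N -> x \in C -> y \in C -> x != y ->
  (5 <= dist x y)%N.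
Proof.
move=> /trifferentP trC C2 xC yC xy.
have [z] : exists z, z \in C :\ x :\ y.
  apply/set0Pn; rewrite -card_gt0.
  have yC' : y \in C :\ x by rewrite !inE eq_sym xy.
  by move: C2; rewrite (cardsD1 x C) xC (cardsD1 y (C :\ x)) yC' !add1n.
rewrite !inE => /and3P[zy zx zC].
apply: (leq_trans (trC x y z xC yC zC xy _ _)); rewrite 1?eq_sym //.
apply: subset_leq_card; apply/subsetP => i; rewrite !inE triffer_atE.
by case/and3P.
Qed.

(** * Harmonic analysis on ternary words *)

(** The sum of the two nontrivial characters of Z/3 at s - t: 2 on the diagonal, -1 off it. *)
Definition theta (s t : 'I_3) : rat := 3 * (s == t)%:R - 1.

Lemma sum_theta_mul s t : \sum_u theta s u * theta t u = 3 * theta s t.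
Proof.
by case: s => [[|[|[|//]]] ?]; case: t => [[|[|[|//]]] ?];
  rewrite !big_ord_recl big_ord0 /theta /=; ring.
Qed.

(** By [sum_theta_mul] the kernel convolved with itself is 3^n times the kernel, so the double sum
    is a sum of squares up to this factor. *)
Lemma theta_kernel_ge0 n (C : {set word n}) (S : {set 'I_n}) :
  0 <= \sum_(x in C) \sum_(y in C) \prod_(i in S) theta (x i) (y i).
Proof.
pose h (x r : word n) := \prod_(i in S) theta (x i) (r i).
have conv x y : \sum_r h x r * h y r = 3 ^+ n * h x y.
  under eq_bigr do rewrite -big_split /= big_mkcond.
  rewrite -(bigA_distr_bigA (fun i s =>
     if i \in S then theta (x i) s * theta (y i) s else 1)).
  rewrite [h x y]big_mkcond -[X in 3 ^+ X](card_ord n) -prodr_const -big_split /=.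
  apply: eq_bigr => i _; case: (i \in S); first exact: sum_theta_mul.
  by rewrite sumr_const card_ord mulr1.
rewrite -(pmulr_rge0 _ (_ : 0 < 3 ^+ n)) ?exprn_gt0 //.
have -> : 3 ^+ n * (\sum_(x in C) \sum_(y in C) h x y)
    = \sum_r (\sum_(x in C) h x r) ^+ 2.
  under [RHS]eq_bigr do rewrite expr2 big_distrlr /=.
  rewrite [RHS]exchange_big mulr_sumr; apply: eq_bigr => x _.
  rewrite [RHS]exchange_big mulr_sumr; apply: eq_bigr => y _.
  by rewrite conv.
by apply: sumr_ge0 => r _; apply: sqr_ge0.
Qed.

(** Every S contributes a nonnegative amount; only the empty set is kept. *)
Lemma spectral_bound n (C : {set word n}) (w : nat -> rat) :
  (forall j, (j <= n)%N -> 0 <= w j) ->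
  w 0%N * #|C|%:R ^+ 2 <= \sum_(x in C) \sum_(y in C)
     \sum_(S : {set 'I_n}) w #|S| * \prod_(i in S) theta (x i) (y i).
Proof.
move=> w0.
have -> : \sum_(x in C) \sum_(y in C)
     \sum_(S : {set 'I_n}) w #|S| * \prod_(i in S) theta (x i) (y i)
  = \sum_(S : {set 'I_n}) w #|S| *
     \sum_(x in C) \sum_(y in C) \prod_(i in S) theta (x i) (y i).
  under [RHS]eq_bigr do rewrite mulr_sumr.
  rewrite [RHS]exchange_big; apply: eq_bigr => x _ /=.
  under [RHS]eq_bigr do rewrite mulr_sumr.
  by rewrite [RHS]exchange_big.
rewrite (bigD1 set0) //= cards0.
have -> : \sum_(x in C) \sum_(y in C) \prod_(i in set0) theta (x i) (y i)
   = #|C|%:R ^+ 2.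
  under eq_bigr do (under eq_bigr do rewrite big_set0).
  by rewrite !sumr_const -mulrnA mulnn natrX.
rewrite lerDl sumr_ge0 // => S _; rewrite mulr_ge0 ?theta_kernel_ge0 //.
by rewrite w0 // -[leqRHS]card_ord max_card.
Qed.

(** Only singletons S are used: [theta] summed over the positions is 3 agree - n = 2n - 3 dist. *)
Lemma plotkin n (C : {set word n}) :
  \sum_(x in C) \sum_(y in C) (dist x y)%:R <= 2 / 3 * n%:R * #|C|%:R ^+ 2 :> rat.
Proof.
have : 0 <= \sum_(x in C) \sum_(y in C) (2 * n%:R - 3 * (dist x y)%:R) :> rat.
  have -> : \sum_(x in C) \sum_(y in C) (2 * n%:R - 3 * (dist x y)%:R) =
     \sum_(i < n) \sum_(x in C) \sum_(y in C) \prod_(k in [set i]) theta (x k) (y k).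
    rewrite [RHS]exchange_big; apply: eq_bigr => x _ /=.
    rewrite [RHS]exchange_big; apply: eq_bigr => y _ /=.
    under [RHS]eq_bigr do rewrite big_set1 /theta.
    rewrite sumrB -mulr_sumr -natr_sum -card_set_sum -/(agree x y).
    rewrite sumr_const card_ord.
    have : (agree x y)%:R + (dist x y)%:R = n%:R :> rat.
      by rewrite -natrD agree_dist.
    lra.
  by apply: sumr_ge0 => i _; apply: theta_kernel_ge0.
under eq_bigr do rewrite sumrB sumr_const -mulr_sumr.
rewrite sumrB sumr_const -mulr_sumr -mulrnA mulnn -[_ *+ (_ ^ 2)]mulr_natr natrX.
lra.
Qed.

(* A Krawtchouk polynomial up to scaling: at y = (n - 3j)/2 it is l! times the
   coefficient of X^l in (1 + X/2)^(n-j) (1 - X)^j. *)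
Fixpoint kappa (n y : rat) (l : nat) : rat :=
  if l is l1.+1 then
    if l1 is l2.+1 then
      (y + l1%:R / 2) * kappa n y l1 - l1%:R * (n - l2%:R) / 2 * kappa n y l2
    else y
  else 1.

Lemma kappaSS n y l : kappa n y l.+2 =
  (y + l.+1%:R / 2) * kappa n y l.+1 - l.+1%:R * (n - l%:R) / 2 * kappa n y l.
Proof. by []. Qed.

Definition kpoly (k j : nat) : {poly rat} :=
  (1 + (1 / 2)%:P * 'X) ^+ k * (1 - 'X) ^+ j.

Lemma mul_deriv_exp (p : {poly rat}) k : p * (p ^+ k)^`() = k%:R * p^`() * p ^+ k.
Proof.
rewrite deriv_exp; case: k => [|k] /=; first by rewrite mulr0n mul0r mulr0 mul0r.
by rewrite -mulr_natl exprS; ring.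
Qed.

(** The logarithmic derivative of [kpoly], cleared of denominators; its coefficients give the
    recurrence defining [kappa]. *)
Lemma kpoly_deriv k j :
  (kpoly k j)^`() + (1 / 2 - 1)%:P * ('X * (kpoly k j)^`())
     - (1 / 2)%:P * ('X * ('X * (kpoly k j)^`()))
  = (k%:R / 2 - j%:R)%:P * kpoly k j - ((k + j)%:R / 2)%:P * ('X * kpoly k j).
Proof.
rewrite /kpoly derivM.
set c : rat := 1 / 2; set A := 1 + c%:P * 'X; set D := 1 - 'X.
have dA : A^`() = c%:P by rewrite /A !derivE add0r mulr1.
have dD : D^`() = -1 by rewrite /D !derivE sub0r.
have eA := mul_deriv_exp A k; have eD := mul_deriv_exp D j.
rewrite dA in eA; rewrite dD in eD.
have -> : k%:R / 2 - j%:R = c * k%:R - j%:R :> rat by rewrite /c; field.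
have -> : (k + j)%:R / 2 = c * (k%:R + j%:R) :> rat by rewrite /c natrD; field.
set a := (A ^+ k)^`() in eA *; set d := (D ^+ j)^`() in eD *.
have -> : (c - 1)%:P = c%:P - 1 by rewrite polyCB.
rewrite polyCB (polyCM c k%:R) (polyCM c (k%:R + j%:R)) polyCD !polyC_natr.
have -> : a * D ^+ j + A ^+ k * d + (c%:P - 1) * ('X * (a * D ^+ j + A ^+ k * d))
   - c%:P * ('X * ('X * (a * D ^+ j + A ^+ k * d)))
  = (A * a) * D * D ^+ j + (D * d) * A * A ^+ k by rewrite /A /D; ring.
by rewrite eA eD /A /D; ring.
Qed.

Lemma kappaE n j l : (j <= n)%N ->
  kappa n%:R ((n%:R - 3 * j%:R) / 2) l = l`!%:R * (kpoly (n - j) j)`_l.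
Proof.
move=> le; set Q := kpoly _ _; set y := _ / 2.
have y_def : (n - j)%:R / 2 - j%:R = y by rewrite /y natrB //; field.
have := kpoly_deriv (n - j) j; rewrite -/Q y_def subnK // => E.
have E0 : Q`_1 = y * Q`_0.
  have := congr1 (fun p : {poly rat} => p`_0) E.
  by rewrite !(coefN, coefD, coefCM, coefXM, coef_deriv) /= => H; lra.
have ES k : (k.+2)%:R * Q`_k.+2 =
    (y + k.+1%:R / 2) * Q`_k.+1 - (n%:R - k%:R) / 2 * Q`_k.
  have := congr1 (fun p : {poly rat} => p`_k.+1) E.
  rewrite !(coefN, coefD, coefCM, coefXM, coef_deriv) /=.
  case: k => [|k] /= H; first by move: H; rewrite mulr1n mulr2n; lra.
  lra.
have Q0 : Q`_0 = 1.
  rewrite -horner_coef0 /Q /kpoly hornerM !horner_exp !hornerE.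
  by rewrite !expr1n mulr1.
(* The recurrence reaches back two steps, so two consecutive indices are carried along. *)
have [] : kappa n%:R y l = l`!%:R * Q`_l /\ kappa n%:R y l.+1 = l.+1`!%:R * Q`_l.+1.
  elim: l => [|l [IH1 IH2]]; first by rewrite E0 Q0 /= !mul1r mulr1.
  split=> //; rewrite kappaSS IH1 IH2 [l.+2`!]factS natrM [X in _ = X]mulrAC ES.
  by rewrite factS natrM; ring.
by [].
Qed.

(** The sum over S expands a product over positions with factor (theta / 4)(1 - X) + (1 + X/2),
    which is 3/2 where x and y agree and (3/4)(1 + X) where they differ. *)
Lemma kernel_kappa n (x y : word n) l :
  \sum_(S : {set 'I_n}) (4 ^- #|S| * kappa n%:R ((n%:R - 3 * #|S|%:R) / 2) l)
      * \prod_(i in S) theta (x i) (y i)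
  = (3 / 2) ^+ n * (2 ^- dist x y * (dist x y ^_ l)%:R).
Proof.
have gen : \sum_(S : {set 'I_n})
    (4 ^- #|S| * \prod_(i in S) theta (x i) (y i))%:P * kpoly (n - #|S|) #|S|
  = ((3 / 2) ^+ n * 2 ^- dist x y)%:P * (1 + 'X) ^+ dist x y.
  transitivity (\prod_i ((theta (x i) (y i) / 4)%:P * (1 - 'X)
                          + (1 + (1 / 2)%:P * 'X)) : {poly rat}).
    rewrite bigA_distr; apply: eq_bigr => S _.
    rewrite [RHS](bigID (fun i => i \in S)) /=.
    rewrite [X in _ = X * _](eq_bigr
      (fun i => (theta (x i) (y i) / 4)%:P * (1 - 'X))); last first.
      by move=> i ->.
    rewrite [X in _ = _ * X](eq_bigr (fun=> 1 + (1 / 2)%:P * 'X)); last first.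
      by move=> i /negPf ->.
    rewrite big_split /= !prodr_const -rmorph_prod /= big_split /= prodr_const.
    rewrite exprVn [_ * 4 ^- _]mulrC /kpoly -!mulrA; congr (_ * _).
    rewrite mulrC; congr (_ * _ ^+ _).
    have -> : (n - #|S| = #|~: S|)%N.
      by have := cardsC S; rewrite card_ord => E; rewrite -[X in (X - _)%N]E addKn.
    by apply: eq_card => i; rewrite !inE.
  rewrite (eq_bigr (fun i => (3 / 2)%:P *
      (if x i != y i then (1 / 2)%:P * (1 + 'X) else 1))); last first.
    move=> i _; rewrite /theta; case: (x i == y i) => /=.
      rewrite mulr1 (_ : (3 * 1 - 1) / 4 = 1 / 2) //.
      by rewrite (_ : 3 / 2 = 1 + 1 / 2) // polyCD; ring.
    rewrite (_ : (3 * 0 - 1) / 4 = 1 / 2 * (1 / 2) - 1 / 2) //.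
    rewrite (_ : 3 / 2 = 1 + 1 / 2) // polyCB polyCD (polyCM (1 / 2)).
    have : (1 / 2)%:P + (1 / 2)%:P - 1 = 0 :> {poly rat} by rewrite -polyCD -polyCB.
    set e := (1 / 2)%:P => e0; apply/eqP; rewrite eq_sym -subr_eq0.
    rewrite (_ : _ - _ = (e + e - 1) * (1 + e * 'X)); last by ring.
    by rewrite e0 mul0r.
  rewrite big_split /= prodr_const card_ord -big_mkcond /= prodr_const.
  rewrite exprMn -!polyC_exp mulrA -polyCM.
  by rewrite /dist cardsE div1r exprVn.
have := congr1 (fun p : {poly rat} => l`!%:R * p`_l) gen.
rewrite coef_sum mulr_sumr coefCM coef_exp1DX => E.
transitivity ((3 / 2) ^+ n * 2 ^- dist x y * (l`!%:R * 'C(dist x y, l)%:R) : rat).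
  rewrite mulrCA -E; apply: eq_bigr => S _.
  rewrite kappaE; first by rewrite coefCM; ring.
  by rewrite -[leqRHS]card_ord max_card.
by rewrite -natrM mulnC bin_ffact mulrA.
Qed.

(** * The linear programming polynomial *)

(** Coordinates of the degree 9 function f(y) in [kappa n y 0], ..., [kappa n y 9]; [kcoefE]
    verifies them. *)
Definition kcoef (n : rat) : seq rat :=
 [:: 9/500 * n^+6 + 291/1000*n^+5 + (1 + 101/1000)*n^+4 - (14 + 61/100)*n^+3
       + (31 + 1/5)*n^+2 - 18*n;
     57/125*n^+5 - (16 + 23/1000)*n^+4 + (119 + 577/1000)*n^+3
       - (361 + 41/100)*n^+2 + (473 + 2/5)*n - 216;
     27/250*n^+5 - (1 + 59/250)*n^+4 + (67 + 1/200)*n^+3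
       - (569 + 13/100)*n^+2 + (1634 + 2/5)*n - 1512;
     351/250*n^+4 - (56 + 1/10)*n^+3 + (420 + 27/40)*n^+2 - (1101 + 3/5)*n + 918;
     27/250*n^+4 - (2 + 137/500)*n^+3 + (151 + 23/100)*n^+2
       - (1208 + 7/10)*n + 2529;
     129/125*n^+3 - (47 + 11/20)*n^+2 + (262 + 1/5)*n - (247 + 1/2);
     3/125*n^+3 - 7/50*n^+2 + (79 + 3/5)*n - 426;
     1/5*n^+2 - 13*n + 30;
     1/5*n + 12;
     -1].

Lemma kcoefE n y :
  \sum_(l < 10) (kcoef n)`_l * kappa n y l
    = (3 / 5 * n - y) * (kappa n y 4 + n / 5 * kappa n y 3) ^+ 2.
Proof.
rewrite !big_ord_recr big_ord0 /=.
by field.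
Qed.

Definition fall (x : rat) l : rat := \prod_(i < l) (x - i%:R).

(** The polynomial p(d): by [kernel_kappa] the transform turns each [kappa n y l] into a falling
    factorial of d. *)
Definition kpol (n d : rat) : rat := \sum_(l < 10) (kcoef n)`_l * fall d l.

Definition bpol (d : rat) : rat :=
  1 + d + d * (d - 1) / 2 + d * (d - 1) * (d - 2) / 6.

(* [lra] treats monomials as atoms: once every monomial a^i b^j of degree at most 9
   is known to be nonnegative, it proves the nonnegativity of any polynomial of that
   degree whose coefficients in a and b are nonnegative. *)
Ltac mono_row H i j :=
  pose proof (H i j);
  match j with O => idtac | S ?j' => mono_row H i j' end.
Ltac mono_triangle H i j :=
  mono_row H i j;
  match i with O => idtac | S ?i' => mono_triangle H i' (S j) end.
Ltac lra_monomials H :=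
  rewrite /bpol /kpol !big_ord_recr big_ord0 /fall !big_ord_recr big_ord0 /=;
  mono_triangle H 9%N 0%N; lra.

Lemma monomial_ge0 (a b : rat) : 0 <= a -> 0 <= b ->
  forall i j, 0 <= a ^+ i * b ^+ j.
Proof. by move=> a0 b0 i j; rewrite mulr_ge0 ?exprn_ge0. Qed.

(* Three ranges: 5 <= d <= n/2 here, n/2 <= d <= n - 16 in [kpol_le_middle], and
   n - 16 < d <= n with n >= 32 in [kpol_le_large]. *)
Lemma kpol_le_small (a b : rat) : 0 <= a -> 0 <= b ->
  kpol (2 * (5 + b) + a) (5 + b) <= (2 * (5 + b) + a) ^+ 6 / 21 * bpol (5 + b).
Proof. move=> a0 b0; have H := monomial_ge0 a0 b0. lra_monomials H. Qed.

Lemma kpol_le_middle (a b : rat) : 0 <= a -> 0 <= b ->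
  kpol (2 * (16 + b) + a) (16 + b + a)
    <= (2 * (16 + b) + a) ^+ 6 / 21 * bpol (16 + b + a).
Proof. move=> a0 b0; have H := monomial_ge0 a0 b0. lra_monomials H. Qed.

(** Here e = n - d is fixed, so each case is an inequality in the single variable a = n - 32. *)
Lemma kpol_le_large (e : nat) (a : rat) : (e < 16)%N -> 0 <= a ->
  kpol (32 + a) (32 - e%:R + a) <= (32 + a) ^+ 6 / 21 * bpol (32 - e%:R + a).
Proof.
move=> lt a0; have H i : 0 <= a ^+ i by rewrite exprn_ge0.
rewrite /bpol /kpol !big_ord_recr big_ord0 /fall !big_ord_recr big_ord0 /=.
have {H} [] := (conj (H 1) (conj (H 2) (conj (H 3) (conj (H 4) (conj (H 5)
  (conj (H 6) (conj (H 7) (conj (H 8) (H 9)))))))))%N.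
move=> h1 [h2 [h3 [h4 [h5 [h6 [h7 [h8 h9]]]]]]].
do 16 (case: e lt => [_|e lt]; first by lra).
by exfalso; clear -lt.
Qed.

(** The left side will bound a row sum of the transform: the diagonal term plus at most 2 * m^6 / 21
    from the rest. The leading coefficients are 9/500 + 2/21 < 0.12 against 232 * 49 / 64000 >
    0.17. *)
Lemma kcoef0_le (m : rat) : 32 <= m ->
  (kcoef m)`_0 + 2 * (m ^+ 6 / 21) <= 232 / m ^+ 3 *
   (m / 10 * (m * (m - 1) * (m - 2) * (7 * m - 15) / 80) ^+ 2).
Proof.
move=> m32.
have -> : 232 / m ^+ 3 *
   (m / 10 * (m * (m - 1) * (m - 2) * (7 * m - 15) / 80) ^+ 2)
   = 232 / 10 / 6400 * ((m - 1) * (m - 2) * (7 * m - 15)) ^+ 2.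
  by field; lra.
have [a a0 ->] : exists2 a, 0 <= a & m = 32 + a.
  by exists (m - 32); [lra|ring].
have H i : 0 <= a ^+ i by rewrite exprn_ge0.
pose proof (H 1%N); pose proof (H 2%N); pose proof (H 3%N); pose proof (H 4%N).
pose proof (H 5%N); pose proof (H 6%N).
rewrite /=; lra.
Qed.

(** The value of f at y = n/2, that is j = 0: the weight of the empty set. *)
Lemma kappa_top (n : rat) :
  (3 / 5 * n - n / 2) * (kappa n (n / 2) 4 + n / 5 * kappa n (n / 2) 3) ^+ 2
  = n / 10 * (n * (n - 1) * (n - 2) * (7 * n - 15) / 80) ^+ 2.
Proof. by rewrite /=; field. Qed.

(** * The bounds *)

Lemma top_value_gt0 (m : rat) : 32 <= m ->
  0 < m / 10 * (m * (m - 1) * (m - 2) * (7 * m - 15) / 80) ^+ 2.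
Proof.
move=> m32; apply: mulr_gt0; first by lra.
apply: exprn_gt0; apply: mulr_gt0; last by lra.
apply: mulr_gt0; last by lra.
apply: mulr_gt0; last by lra.
apply: mulr_gt0; lra.
Qed.

Lemma kpol0 n : 2 ^- 0 * kpol n 0%:R = (kcoef n)`_0.
Proof.
rewrite expr0 invr1 mul1r.
rewrite /kpol big_ord_recl big1 => [|i _].
  rewrite addr0 /fall big_ord0 mulr1; reflexivity.
by rewrite lift0 /fall big_ord_recl subrr mul0r mulr0.
Qed.

Lemma distxx n (x : word n) : dist x x = 0%N.
Proof. by apply/eqP; rewrite cards_eq0; apply/eqP/setP => i; rewrite !inE eqxx. Qed.

Lemma dist_le n (x y : word n) : (dist x y <= n)%N.
Proof. by have := agree_dist x y; lia. Qed.

Lemma fall_natr d l : fall d%:R l = (d ^_ l)%:R.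
Proof.
rewrite /fall; elim: l => [|l IH]; first by rewrite big_ord0 ffactn0.
rewrite big_ord_recr /= IH ffactnSr natrM.
have [le|lt] := leqP l d; first by rewrite natrB.
by rewrite ffact_small // !mul0r.
Qed.

Lemma bpol_natr d : bpol d%:R = (ball3 d)%:R.
Proof.
rewrite /bpol /ball3 !natrD; congr (_ + _ + _ + _).
  have := fall_natr d 2; rewrite -bin_ffact natrM /fall !big_ord_recr big_ord0 /=.
  by rewrite mul1r subr0 => ->; rewrite mulfK.
have := fall_natr d 3; rewrite -bin_ffact natrM /fall !big_ord_recr big_ord0 /=.
by rewrite mul1r subr0 => ->; rewrite mulfK.
Qed.

(** The points y = (n - 3j)/2 satisfy y <= n/2, so nonnegativity of f there makes the weights 4^-j
    f(y) nonnegative. *)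
Lemma kappa_spectral_bound n (C : {set word n}) L (c : nat -> rat) (f : rat -> rat) :
  (forall y, \sum_(l < L) c l * kappa n%:R y l = f y) ->
  (forall y, y <= n%:R / 2 -> 0 <= f y) ->
  f (n%:R / 2) * #|C|%:R ^+ 2 <= (3 / 2) ^+ n * \sum_(x in C) \sum_(y in C)
     2 ^- dist x y * \sum_(l < L) c l * fall (dist x y)%:R l.
Proof.
move=> fE f0; pose Y (j : nat) : rat := (n%:R - 3 * j%:R) / 2.
pose w (j : nat) : rat := 4 ^- j * f (Y j).
have w0 j : (j <= n)%N -> 0 <= w j.
  move=> _; apply: mulr_ge0; first by rewrite invr_ge0 exprn_ge0.
  apply: f0; rewrite /Y; have := ler0n rat j; lra.
have := spectral_bound C w0.
rewrite {1}/w expr0 invr1 mul1r /Y mulr0 subr0 => /le_trans; apply.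
rewrite le_eqVlt; apply/orP; left; apply/eqP.
rewrite mulr_sumr; apply: eq_bigr => x _; rewrite mulr_sumr; apply: eq_bigr => y _.
transitivity (\sum_(l < L) c l * \sum_(S : {set 'I_n})
    (4 ^- #|S| * kappa n%:R (Y #|S|) l) * \prod_(i in S) theta (x i) (y i)).
  under [RHS]eq_bigr do rewrite mulr_sumr.
  rewrite [RHS]exchange_big; apply: eq_bigr => S _ /=.
  by rewrite /w -fE mulr_sumr mulr_suml; apply: eq_bigr => l _; ring.
rewrite !mulr_sumr; apply: eq_bigr => l _.
by rewrite kernel_kappa fall_natr; ring.
Qed.

Lemma kpol_le n d : (32 <= n)%N -> (5 <= d <= n)%N ->
  kpol n%:R d%:R <= n%:R ^+ 6 / 21 * (ball3 d)%:R.
Proof.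
move=> n32 /andP[d5 dn]; rewrite -bpol_natr.
have [small|large] := leqP (2 * d) n.
  have -> : n%:R = 2 * (5 + (d - 5)%:R) + (n - 2 * d)%:R :> rat.
    by rewrite !natrB // natrM; ring.
  have -> : d%:R = 5 + (d - 5)%:R :> rat by rewrite natrB //; ring.
  by apply: kpol_le_small.
have [middle|big] := leqP 16 (n - d).
  have -> : n%:R = 2 * (16 + (n - d - 16)%:R) + (2 * d - n)%:R :> rat.
    rewrite !natrB ?natrM //; [ring|lia].
  have -> : d%:R = 16 + (n - d - 16)%:R + (2 * d - n)%:R :> rat.
    rewrite !natrB ?natrM //; [ring|lia].
  by apply: kpol_le_middle.
have := kpol_le_large big (ler0n _ (n - 32)).
rewrite (_ : 32 + (n - 32)%:R = n%:R); last by rewrite natrB //; ring.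
by rewrite (_ : 32 - _ + _ = d%:R) // !natrB //; ring.
Qed.

Lemma card_le2_bound n (M : nat) : (5 <= n)%N -> (M <= 2)%N ->
  M%:R <= (3 / 2) ^+ n * (232 / n%:R ^+ 3) :> rat.
Proof.
(* Here 116 = 232 / 2. The ratio ((n + 1)/n)^3 is at most 3/2 from n = 7 on, where the induction
   starts. *)
move=> n5 M2; have cube : n%:R ^+ 3 <= 116 * (3 / 2) ^+ n :> rat.
  have [n7|] := ltnP n 7.
    have [->|->] : n = 5%N \/ n = 6%N by lia.
      lra.
    lra.
  move=> n7; rewrite -(subnKC n7); elim: (n - 7)%N => [|k IH]; first by lra.
  rewrite addnS -natr1 [(3 / 2) ^+ _]exprS; move: IH; rewrite natrD.
  have := ler0n rat k; move: k%:R => a a0.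
  have a2 : 0 <= a ^+ 2 by apply: exprn_ge0.
  have a3 : 0 <= a ^+ 3 by apply: exprn_ge0.
  move: ((3 / 2) ^+ _) => p IH; lra.
have n0 : 0 < n%:R ^+ 3 :> rat by rewrite exprn_gt0 // ltr0n; lia.
apply: (@le_trans _ _ 2%:R); first by rewrite ler_nat.
rewrite mulrA ler_pdivlMr //; lra.
Qed.

(** Each row of the transform sums to at most (3/2)^n (232/m^3) f(m/2), while f(m/2) M^2 bounds the
    total from below; cancel M f(m/2). *)
Lemma bound5_large n (C : {set word n}) : (32 <= n)%N -> trifferent 5 C ->
  (2 < #|C|)%N -> #|C|%:R <= (3 / 2) ^+ n * (232 / n%:R ^+ 3) :> rat.
Proof.
move=> n32 trC C2; set m : rat := n%:R; set M : rat := #|C|%:R.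
have m32 : 32 <= m by rewrite (ler_nat _ 32).
have M0 : 0 < M by rewrite ltr0n; lia.
pose f := m / 10 * (m * (m - 1) * (m - 2) * (7 * m - 15) / 80) ^+ 2.
have f0 : 0 < f by apply: top_value_gt0.
have row x : x \in C ->
    \sum_(y in C) 2 ^- dist x y * kpol m (dist x y)%:R
      <= (kcoef m)`_0 + 2 * (m ^+ 6 / 21).
  move=> xC; rewrite (big_setD1 x xC) /= distxx; apply: lerD.
    by rewrite (kpol0 m) lexx.
  apply: (@le_trans _ _ (m ^+ 6 / 21 *
     \sum_(y in C :\ x) (ball3 (dist x y))%:R / 2 ^+ dist x y)).
    rewrite mulr_sumr; apply: ler_sum => y; rewrite !inE => /andP[yx yC].
    rewrite mulrA mulrC ler_wpM2r ?invr_ge0 ?exprn_ge0 //.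
    apply: kpol_le => //; rewrite dist_le andbT.
    by apply: (dist_ge5 trC) => //; rewrite eq_sym.
  rewrite [leRHS]mulrC ler_wpM2l ?weighted_dist_sum //.
  by rewrite divr_ge0 ?exprn_ge0 //; lra.
have key : f * M ^+ 2 <= (3 / 2) ^+ n * \sum_(x in C) \sum_(y in C)
    2 ^- dist x y * kpol m (dist x y)%:R.
  have := kappa_spectral_bound C (kcoefE m); rewrite kappa_top; apply => y ym.
  by apply: mulr_ge0; [move: ym m32; rewrite -/m; lra|apply: sqr_ge0].
have : f * M ^+ 2 <= (3 / 2) ^+ n * (M * (232 / m ^+ 3 * f)).
  apply: (le_trans key); apply: ler_wpM2l; first by apply: exprn_ge0.
  have le := kcoef0_le m32; rewrite -/f in le.
  set K := (kcoef m)`_0 + _ in row le; clearbody K.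
  apply: (@le_trans _ _ (\sum_(x in C) K)); first exact: ler_sum.
  by rewrite sumr_const -[K *+ _]mulr_natl; apply: ler_wpM2l; [apply: ltW|].
have -> : f * M ^+ 2 = M * (f * M) by ring.
have -> : (3 / 2) ^+ n * (M * (232 / m ^+ 3 * f))
   = M * (f * ((3 / 2) ^+ n * (232 / m ^+ 3))) by ring.
by rewrite !ler_pM2l.
Qed.

(** * Convexity and Plotkin's bound for n < 32 *)

Definition ball3_ratio (d : nat) : rat := (ball3 d)%:R / 2 ^+ d.

(** The second difference at d is 2^-d d(d - 1)(d - 5)/24. *)
Lemma ball3_ratio_convex d : (5 <= d)%N ->
  ball3_ratio d.+1 - ball3_ratio d <= ball3_ratio d.+2 - ball3_ratio d.+1.
Proof.
move=> d5; rewrite /ball3_ratio -!bpol_natr !exprS -!natr1.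
have p0 : 0 < (2 : rat) ^+ d by rewrite exprn_gt0.
rewrite -subr_ge0 -(pmulr_rge0 _ p0).
set D : rat := d%:R; have D5 : 5 <= D by rewrite (ler_nat _ 5).
have -> : 2 ^+ d * (bpol (D + 1 + 1) / (2 * (2 * 2 ^+ d))
       - bpol (D + 1) / (2 * 2 ^+ d) - (bpol (D + 1) / (2 * 2 ^+ d) - bpol D / 2 ^+ d))
   = D * (D - 1) * (D - 5) / 24.
  by rewrite /bpol; field; lra.
by rewrite !mulr_ge0 ?invr_ge0 //; lra.
Qed.

(** Convexity keeps the sequence above the line through its values at d0 and d0 + 1, on both
    sides. *)
Lemma ball3_ratio_chord d0 d : (5 <= d0)%N -> (5 <= d)%N ->
  ball3_ratio d0 + (ball3_ratio d0.+1 - ball3_ratio d0) * (d%:R - d0%:R)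
    <= ball3_ratio d.
Proof.
pose D i := ball3_ratio i.+1 - ball3_ratio i; rewrite -/(D d0).
have Dm i k : (5 <= i)%N -> D i <= D (i + k)%N.
  move=> i5; elim: k => [|k IH]; first by rewrite addn0.
  by rewrite (le_trans IH) // addnS ball3_ratio_convex //; lia.
have up i k : (5 <= i)%N ->
    ball3_ratio i + D i * k%:R <= ball3_ratio (i + k).
  move=> i5; elim: k => [|k IH]; first by rewrite addn0 mulr0 addr0.
  by have := Dm i k i5; rewrite addnS -natr1 {2}/D; lra.
have down i k : (5 <= i)%N ->
    ball3_ratio (i + k) - D (i + k)%N * k%:R <= ball3_ratio i.
  move=> i5; elim: k => [|k IH]; first by rewrite addn0 mulr0 subr0.
  have := Dm (i + k)%N 1%N ltac:(lia); rewrite addn1 addnS -natr1.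
  have : 0 <= k%:R :> rat by [].
  move=> k0 le; have le2 := ler_wpM2r k0 le.
  have : D (i + k)%N = ball3_ratio (i + k).+1 - ball3_ratio (i + k) by [].
  by move: (D _) (D _) le le2 IH => a b; lra.
move=> d05 d5; have [le|lt] := leqP d0 d.
  by have := up d0 (d - d0)%N d05; rewrite subnKC // natrB.
have := down d (d0 - d)%N d5; rewrite subnKC ?(ltnW lt) // natrB ?(ltnW lt) //.
by lra.
Qed.

(** Replace each summand of [weighted_dist_sum] by its chord, sum over x, and bound the total
    distance by [plotkin]; v <= u makes the slope nonpositive, so an upper bound on distances
    serves. *)
Lemma plotkin_bound n (C : {set word n}) d0
    (u := ball3_ratio d0) (v := ball3_ratio d0.+1) :
  trifferent 5 C -> (2 < #|C|)%N -> (5 <= d0)%N -> v <= u ->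
  #|C|%:R * (u + (u - v) * (d0%:R - 2 / 3 * n%:R)) <= 2 + u + (u - v) * d0%:R.
Proof.
move=> trC C2 d05 vu; set M : rat := #|C|%:R.
have M0 : 0 < M by rewrite ltr0n; lia.
have row x : x \in C ->
    (M - 1) * (u + (u - v) * d0%:R) - (u - v) * \sum_(y in C) (dist x y)%:R <= 2.
  move=> xC; apply: le_trans (weighted_dist_sum trC xC).
  have -> : M - 1 = #|C :\ x|%:R.
    by rewrite /M (cardsD1 x) xC add1n -natr1 addrK.
  rewrite (big_setD1 x xC) /= distxx add0r mulr_natl -sumr_const.
  rewrite mulr_sumr -sumrB; apply: ler_sum => y; rewrite !inE => /andP[yx yC].
  have d5 : (5 <= dist x y)%N by apply: (dist_ge5 trC) => //; rewrite eq_sym.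
  have := ball3_ratio_chord d05 d5; rewrite -/u -/v -/(ball3_ratio _); lra.
set K := (M - 1) * _ in row.
have KE : K = (M - 1) * (u + (u - v) * d0%:R) by [].
clearbody K.
have : \sum_(x in C) (K - (u - v) * \sum_(y in C) (dist x y)%:R)
    <= \sum_(x in C) 2 :> rat by exact: ler_sum.
rewrite sumrB -mulr_sumr !sumr_const.
rewrite -(mulr_natl K) -(mulr_natl 2) -/M {K row}KE.
have := plotkin C; rewrite -/M => pl.
have := ler_wpM2l (_ : 0 <= u - v) pl; rewrite subr_ge0 => /(_ vu).
set S := \sum_(x in C) _ => le1 le2.
rewrite -(ler_pM2l M0).
have -> : M * (M * (u + (u - v) * (d0%:R - 2 / 3 * n%:R)))
   = M * ((M - 1) * (u + (u - v) * d0%:R)) - (u - v) * (2 / 3 * n%:R * M ^+ 2)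
     + M * (u + (u - v) * d0%:R) by ring.
lra.
Qed.

(** The chord is taken near the Plotkin mean 2n/3, but not below 5, where convexity starts; the 27
    lengths from 5 to 31 are then rational arithmetic. *)
Lemma plotkin_numeric k (M : rat) : (k < 27)%N -> 0 <= M ->
  let n := (5 + k)%N in let d0 := maxn 5 (2 * n %/ 3) in
  let u := bpol d0%:R / 2 ^+ d0 in let v := bpol d0.+1%:R / 2 ^+ d0.+1 in
  (v <= u ->
   M * (u + (u - v) * (d0%:R - 2 / 3 * n%:R)) <= 2 + u + (u - v) * d0%:R) ->
  M <= (3 / 2) ^+ n * (232 / n%:R ^+ 3).
Proof.
rewrite /bpol => k27 M0.
do 27 (case: k k27 => [|k] k27; [
  set N := (5 + _)%N; vm_compute in N; rewrite /N {N};
  set d0 := maxn _ _; vm_compute in d0; rewrite /d0 /= {d0} => H;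
  have {}H := H ltac:(lra); lra
  |]).
by exfalso; clear -k27.
Qed.

Lemma bound5_small n (C : {set word n}) : (5 <= n < 32)%N -> trifferent 5 C ->
  (2 < #|C|)%N -> #|C|%:R <= (3 / 2) ^+ n * (232 / n%:R ^+ 3) :> rat.
Proof.
move=> /andP[n5 n31] trC C2.
have := @plotkin_bound n C (maxn 5 (2 * n %/ 3)) trC C2 (leq_maxl _ _).
rewrite /ball3_ratio -!bpol_natr.
have k27 : (n - 5 < 27)%N by lia.
by have := plotkin_numeric k27 (ler0n rat #|C|); rewrite subnKC.
Qed.

(** * From codes to [T] *)

Lemma T_le n m (X : rat) : 0 <= X ->
  (forall C : {set word n}, trifferent m C -> #|C|%:R <= X) -> (T n m)%:R <= X.
Proof.
move=> X0 H; rewrite /T; elim/big_ind: _ => //= a b aX bX.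
by case: leqP.
Qed.

Lemma natr_le_ratio (M n c k : nat) : (0 < n)%N ->
  (M * n ^ k * 2 ^ n <= c * 3 ^ n)%N ->
  M%:R <= (3%:R / 2%:R) ^+ n * (c%:R / n%:R ^+ k) :> rat.
Proof.
move=> n0; rewrite -(ler_nat rat) !natrM !natrX => le.
have p2 : 0 < (2%:R : rat) ^+ n by apply: exprn_gt0.
have pn : 0 < (n%:R : rat) ^+ k by apply: exprn_gt0; rewrite ltr0n.
by rewrite expr_div_n mulrA ler_pdivlMr // mulrAC ler_pdivlMr // [leRHS]mulrC.
Qed.

(** At most 5 codewords agree at most once with a given r, so M (n + 2) 2^(n - 1) <= 5 * 3^n. *)
Lemma bound2 n (C : {set word n}) : (2 <= n)%N -> trifferent 2 C ->
  (#|C| * n ^ 1 * 2 ^ n <= 10 * 3 ^ n)%N.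
Proof.
move=> n2 trC; have := ball_bound (fun r => @sparse_agree_le5 n 2 1 C r trC isT).
rewrite !big_ord_recr big_ord0 /= bin0 bin1 subn0 expn1.
have -> : (2 ^ n = 2 * 2 ^ (n - 1))%N by rewrite -expnS; congr (_ ^ _)%N; lia.
by move: (2 ^ _)%N (3 ^ _)%N #|C| => q p M; nia.
Qed.

(** At most 5 codewords agree at most twice with a given r, so M (C(n,2) + 2n + 4) 2^(n - 2) <= 5 *
    3^n, and the bracket exceeds n^2 / 2. *)
Lemma bound4 n (C : {set word n}) : (4 <= n)%N -> trifferent 4 C ->
  (#|C| * n ^ 2 * 2 ^ n <= 44 * 3 ^ n)%N.
Proof.
move=> n4 trC; have := ball_bound (fun r => @sparse_agree_le5 n 4 2 C r trC isT).
rewrite !big_ord_recr big_ord0 /= bin0 bin1 subn0.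
have -> : (2 ^ n = 4 * 2 ^ (n - 2))%N by rewrite -(expnD 2 2) subnKC //; lia.
have -> : (2 ^ (n - 1) = 2 * 2 ^ (n - 2))%N by rewrite -expnS; congr (_ ^ _)%N; lia.
have : (2 * 'C(n, 2) + n = n * n)%N.
  rewrite mul2n bin2 halfK oddM; case: n {C trC} n4 => // n _ /=.
  by rewrite andNb subn0; lia.
rewrite -mulnn; move: 'C(_, _) (2 ^ _)%N (3 ^ _)%N #|C| => b q p M eb; nia.
Qed.

Theorem theorem1p6 :
  [/\ (forall n : nat, (3 <= n)%N -> (T n 3 <= T n 2)%N),
      (forall n : nat, (2 <= n)%N ->
         (T n 2)%:R <= (3%:R / 2%:R) ^+ n * (10%:R / n%:R) :> rat),
      (forall n : nat, (4 <= n)%N ->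
         (T n 4)%:R <= (3%:R / 2%:R) ^+ n * (44%:R / n%:R ^+ 2) :> rat)
    & (forall n : nat, (5 <= n)%N ->
         (T n 5)%:R <= (3%:R / 2%:R) ^+ n * (232%:R / n%:R ^+ 3) :> rat)].
Proof.
have pos (c n k : nat) : 0 <= (3%:R / 2%:R) ^+ n * (c%:R / n%:R ^+ k) :> rat.
  apply: mulr_ge0; first by apply: exprn_ge0.
  by apply: divr_ge0; [apply: ler0n|apply: exprn_ge0].
split=> [n _|n n2|n n4|n n5].
- apply/bigmax_leqP => C trC; apply: (@leq_bigmax_cond _ _ _ C).
  apply/trifferentP => x y z xC yC zC xy yz xz.
  by apply: ltnW; apply: (trifferentP _ _ trC).
- rewrite -[n%:R]expr1; apply: T_le => [|C trC]; first exact: pos.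
  by apply: natr_le_ratio (bound2 n2 trC); lia.
- apply: T_le => [|C trC]; first exact: pos.
  by apply: natr_le_ratio (bound4 n4 trC); lia.
apply: T_le => [|C trC]; first exact: pos.
(* The minimum distance 5 comes from a third codeword, so codes of size at most 2 are treated
   apart. *)
have [C2|C2] := leqP #|C| 2; first exact: card_le2_bound.
have [n32|n32] := ltnP n 32; last exact: bound5_large.
by apply: bound5_small; rewrite ?n5.
Qed.
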